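(* For all integers $n>d\ge1$, $$A(n,d)\ge\binom{n-1}{d-1}^{-1}d^d\,n^{n-2d}.$$ Further, if $d>\frac n2$, then $$A(n,d)\ge\binom{n-1}{d-1}^{-1}\left(\frac n2\right)^{n-d}.$$
   Context: $[n]=\{1,\dots,n\}$, and $\mathcal{T}(n)$ is the set of all spanning trees of the complete graph on vertex set $[n]$. The tree-distance of $T_1=([n],E_1)$ and $T_2=([n],E_2)$ in $\mathcal{T}(n)$ is $d(T_1,T_2)=n-1-|E_1\cap E_2|$. $A(n,d)$ is the maximum size of a set $\mathcal{C}\subseteq\mathcal{T}(n)$ whose distinct elements have pairwise tree-distance at least $d$. *)

(* Defs.v *)
From mathcomp Require Import all_boot all_order all_algebra.

Set Implicit Arguments.
Unset Strict Implicit.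
Unset Printing Implicit Defensive.

(* The vertex set [n] = {1, ..., n} is represented by 'I_n, and a graph on it  *)
(* by its edge set, an edge being a two-element set of vertices.              *)

Definition complete_edges (n : nat) : {set {set 'I_n}} :=
  [set e : {set 'I_n} | #|e| == 2].

Definition adj (n : nat) (E : {set {set 'I_n}}) : rel 'I_n :=
  fun x y => (x != y) && ([set x; y] \in E).

Definition connected_graph (n : nat) (E : {set {set 'I_n}}) : bool :=
  [forall x : 'I_n, forall y : 'I_n, connect (adj E) x y].

(* A cycle visits at least three vertices, all distinct, hence at most n;     *)
(* bounding the length makes the predicate boolean (see acyclic_graphP).      *)
Definition acyclic_graph (n : nat) (E : {set {set 'I_n}}) : bool :=
  [forall k : 'I_n.+1, forall p : (val k).-tuple 'I_n,
     ~~ [&& 2 < size p, uniq p & cycle (adj E) p]].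

Lemma acyclic_graphP (n : nat) (E : {set {set 'I_n}}) :
  reflect (forall p : seq 'I_n, 2 < size p -> uniq p -> ~~ cycle (adj E) p)
          (acyclic_graph E).
Proof.
apply: (iffP idP) => [acE p p_gt2 p_uniq | acE].
  have p_le : size p < n.+1.
    by rewrite ltnS -[n in _ <= n]card_ord -(card_uniqP p_uniq) max_card.
  have /forallP/(_ (Ordinal p_le))/forallP/(_ (in_tuple p)) := acE.
  by rewrite /= p_gt2 p_uniq.
apply/forallP => k; apply/forallP => p; apply/negP => /and3P[p_gt2 p_uniq].
exact/negP/acE.
Qed.

Definition is_spanning_tree (n : nat) (E : {set {set 'I_n}}) : bool :=
  [&& E \subset complete_edges n, connected_graph E & acyclic_graph E].

Definition spanning_trees (n : nat) : {set {set {set 'I_n}}} :=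
  [set E | is_spanning_tree E].

(* The truncated subtraction is harmless: a tree on n vertices has n - 1      *)
(* edges.                                                                     *)
Definition tree_dist (n : nat) (E1 E2 : {set {set 'I_n}}) : nat :=
  n - 1 - #|E1 :&: E2|.

Definition is_tree_code (n d : nat) (C : {set {set {set 'I_n}}}) : bool :=
  (C \subset spanning_trees n) &&
  [forall E1 in C, forall E2 in C, (E1 != E2) ==> (d <= tree_dist E1 E2)].

Definition max_tree_code (n d : nat) : nat :=
  \max_(C : {set {set {set 'I_n}}} | is_tree_code d C) #|C|.

(* Main.v *)
Require Import Defs.
From mathcomp Require Import all_boot all_order all_algebra.
From mathcomp Require Import ring zify.

Set Implicit Arguments.
Unset Strict Implicit.
Unset Printing Implicit Defensive.

Import Order.TTheory GRing.Theory Num.Theory.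

(** The bounds are of Gilbert-Varshamov type. Let C be an inclusion-maximal code
    of trees. By maximality every tree T is at distance less than d from some S
    in C, that is, T shares with S a subforest F of S with n - d edges. Each S
    has 'C(n - 1, d - 1) such subforests, and each of them has d components, so
    the number of trees is at most #|C| * 'C(n - 1, d - 1) times the largest
    number of trees that contain a given forest with d components.

    That number is known exactly: a forest with component sizes a_1, ..., a_d
    lies in n ^ (d - 2) * a_1 * ... * a_d spanning trees (card_extensions; the
    empty forest gives Cayley's formula). The proof is by induction on d,
    counting in two ways the pairs of a tree T containing F and an edge e of T
    outside F. Each T gives d - 1 pairs. An edge e = {x, y} that joins two
    components of F replaces their sizes a(x), a(y) by a(x) + a(y), hence
    multiplies the product of the sizes by 1 / a(x) + 1 / a(y); summing these
    factors over all such edges gives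
      sum_x (n - a(x)) / a(x) = n * (d - 1)
    because sum_x 1 / a(x) is the number of components.

    The two bounds then come from two estimates of the product of the a_i,
    whose sum is n: it is at most (n / d) ^ d by the inequality of the means,
    and at most 2 ^ (n - d) because a <= 2 ^ (a - 1) for every a >= 1. *)

(** * Components of a graph *)

Definition component (n : nat) (F : {set {set 'I_n}}) (x : 'I_n) : {set 'I_n} :=
  [set y | connect (adj F) x y].

Definition components (n : nat) (F : {set {set 'I_n}}) : {set {set 'I_n}} :=
  [set component F x | x : 'I_n].

Lemma adj_connect_sym (n : nat) (F : {set {set 'I_n}}) : connect_sym (adj F).
Proof. by apply: sym_connect_sym => x y; rewrite /adj eq_sym setUC. Qed.

Lemma component_refl (n : nat) (F : {set {set 'I_n}}) (x : 'I_n) :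
  x \in component F x.
Proof. by rewrite inE connect0. Qed.

Lemma component_eq (n : nat) (F : {set {set 'I_n}}) (x y : 'I_n) :
  y \in component F x -> component F y = component F x.
Proof.
rewrite inE => xy; apply/setP => z; rewrite !inE.
by rewrite (same_connect (@adj_connect_sym _ F) xy).
Qed.

Lemma component_eqE (n : nat) (F : {set {set 'I_n}}) (x y : 'I_n) :
  (component F y == component F x) = (y \in component F x).
Proof.
by apply/eqP/idP => [<- | /component_eq //]; apply: component_refl.
Qed.

Lemma mem_component_sym (n : nat) (F : {set {set 'I_n}}) (x y : 'I_n) :
  (y \in component F x) = (x \in component F y).
Proof. by rewrite !inE adj_connect_sym. Qed.

Lemma mem_components (n : nat) (F : {set {set 'I_n}}) (x : 'I_n) :
  component F x \in components F.
Proof. exact: imset_f. Qed.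

Lemma component_closed (n : nat) (F : {set {set 'I_n}}) (x : 'I_n) :
  closed (adj F) (component F x).
Proof.
by move=> y z yz; rewrite !inE (same_connect_r (@adj_connect_sym _ F) (connect1 yz)).
Qed.

Lemma component_min (n : nat) (F : {set {set 'I_n}}) (A : {set 'I_n}) (x : 'I_n) :
  closed (adj F) A -> x \in A -> component F x \subset A.
Proof.
move=> clA Ax; apply/subsetP => y; rewrite inE => xy.
by rewrite -(closed_connect clA xy).
Qed.

Lemma componentS (n : nat) (F F' : {set {set 'I_n}}) (x : 'I_n) :
  F \subset F' -> component F x \subset component F' x.
Proof.
move=> sFF'; apply/subsetP => y; rewrite !inE; apply: connect_sub => u v.
by case/andP => uv /(subsetP sFF') uvF'; apply: connect1; rewrite /adj uv.
Qed.

(** Sets closed under adjacency determine components by minimality, so this is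
    all that is needed to compute the components after adding an edge. *)
Lemma closed_addedge (n : nat) (F : {set {set 'I_n}}) (x y : 'I_n)
    (A : {set 'I_n}) :
  closed (adj F) A -> (x \in A) = (y \in A) ->
  closed (adj ([set x; y] |: F)) A.
Proof.
move=> clA xyA u v /andP[uv]; rewrite in_setU1 => /orP[/eqP E | Fuv]; last first.
  by apply: clA; rewrite /adj uv.
have: u \in [set x; y] by rewrite -E set21.
have: v \in [set x; y] by rewrite -E set22.
by rewrite !inE => /orP[] /eqP -> /orP[] /eqP ->.
Qed.

Lemma component_addedge_same (n : nat) (F : {set {set 'I_n}}) (x y u : 'I_n) :
  y \in component F x -> component ([set x; y] |: F) u = component F u.
Proof.
move=> xy; apply/eqP; rewrite eqEsubset (componentS u (subsetUr _ F)) andbT.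
apply: component_min (component_refl _ _).
apply: closed_addedge; first exact: component_closed.
by rewrite ![_ \in component F u]mem_component_sym -!component_eqE (component_eq xy).
Qed.

Lemma component_addedge_join (n : nat) (F : {set {set 'I_n}}) (x y : 'I_n) :
  component ([set x; y] |: F) x = component F x :|: component F y.
Proof.
set F' := [set x; y] |: F.
have xy : component F' y = component F' x.
  have [-> // | nxy] := eqVneq y x.
  by apply: component_eq; rewrite inE connect1 // /adj eq_sym nxy setU11.
apply/eqP; rewrite eqEsubset; apply/andP; split.
  apply: component_min; last by rewrite in_setU component_refl.
  apply: closed_addedge => [u v uv |]; last by rewrite !in_setU !component_refl orbT.
  by rewrite !in_setU !(component_closed _ uv).
by rewrite subUset -{2}xy !componentS ?subsetUr.
Qed.

Lemma component_addedge_out (n : nat) (F : {set {set 'I_n}}) (x y u : 'I_n) :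
  u \notin component F x :|: component F y ->
  component ([set x; y] |: F) u = component F u.
Proof.
rewrite in_setU negb_or => /andP[ux uy].
apply/eqP; rewrite eqEsubset (componentS u (subsetUr _ F)) andbT.
apply: component_min (component_refl _ _).
apply: closed_addedge; first exact: component_closed.
by rewrite ![_ \in component F u]mem_component_sym (negPf ux) (negPf uy).
Qed.

Lemma components_addedge_same (n : nat) (F : {set {set 'I_n}}) (x y : 'I_n) :
  y \in component F x -> components ([set x; y] |: F) = components F.
Proof.
by move=> xy; apply: eq_imset => u; apply: component_addedge_same.
Qed.

Lemma components_addedge (n : nat) (F : {set {set 'I_n}}) (x y : 'I_n) :
  components ([set x; y] |: F) =
  (component F x :|: component F y)
    |: (components F :\ component F x :\ component F y).
Proof.
set F' := [set x; y] |: F.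
apply/setP => A; rewrite in_setU1 !in_setD1.
apply/imsetP/idP => [[u _ ->] | /orP[/eqP -> | /and3P[Ay Ax /imsetP[u _ defA]]]].
- have [uxy | uxy] := boolP (u \in component F x :|: component F y).
    by rewrite -(component_addedge_join F x y) (component_eq (x := x)) ?eqxx //
      component_addedge_join.
  rewrite component_addedge_out // mem_components !component_eqE.
  by move: uxy; rewrite in_setU negb_or => /andP[-> ->]; rewrite orbT.
- by exists x; rewrite // component_addedge_join.
exists u => //; rewrite component_addedge_out // in_setU negb_or.
by rewrite -!component_eqE -defA Ax Ay.
Qed.

Lemma union_notin_components (n : nat) (F : {set {set 'I_n}}) (x y : 'I_n) :
  y \notin component F x ->
  component F x :|: component F y \notin components F.
Proof.
move=> xy; apply/imsetP => -[u _ E].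
have xu: x \in component F u by rewrite -E in_setU component_refl.
have yu: y \in component F u by rewrite -E in_setU component_refl orbT.
by move/negP: xy; apply; rewrite -component_eqE (component_eq xu) (component_eq yu).
Qed.

(** Together with the next lemma, this compares a quantity computed over the
    components before and after joining two of them: both sides share the big
    operator over the untouched components. *)
Lemma big_components_split (n : nat) (F : {set {set 'I_n}}) (x y : 'I_n)
    (R : Type) (idx : R) (op : Monoid.com_law idx) (G : {set 'I_n} -> R) :
  y \notin component F x ->
  \big[op/idx]_(A in components F) G A =
  op (G (component F x)) (op (G (component F y))
    (\big[op/idx]_(A in components F :\ component F x :\ component F y) G A)).
Proof.
move=> xy; rewrite (big_setD1 (component F x)) ?mem_components //=.
by rewrite (big_setD1 (component F y)) // in_setD1 mem_components component_eqE xy.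
Qed.

Lemma big_components_addedge (n : nat) (F : {set {set 'I_n}}) (x y : 'I_n)
    (R : Type) (idx : R) (op : Monoid.com_law idx) (G : {set 'I_n} -> R) :
  y \notin component F x ->
  \big[op/idx]_(A in components ([set x; y] |: F)) G A =
  op (G (component F x :|: component F y))
    (\big[op/idx]_(A in components F :\ component F x :\ component F y) G A).
Proof.
move=> xy; rewrite components_addedge big_setU1 //.
by rewrite !in_setD1 (negPf (union_notin_components xy)) !andbF.
Qed.

Lemma card_components_addedge (n : nat) (F : {set {set 'I_n}}) (x y : 'I_n) :
  y \notin component F x ->
  #|components F| = #|components ([set x; y] |: F)|.+1.
Proof.
move=> xy; rewrite -!sum1_card (big_components_split _ _ xy).
by rewrite (big_components_addedge _ _ xy).
Qed.

Lemma card_component_union (n : nat) (F : {set {set 'I_n}}) (x y : 'I_n) :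
  y \notin component F x ->
  #|component F x :|: component F y| = #|component F x| + #|component F y|.
Proof.
move=> xy; rewrite cardsU disjoint_setI0 ?cards0 ?subn0 //.
rewrite -setI_eq0; apply/eqP/setP => z; rewrite in_setI in_set0.
apply/negP => /andP[zx zy]; move/negP: xy; apply.
by rewrite -component_eqE -(component_eq zy) (component_eq zx).
Qed.

Lemma sum_component (n : nat) (R : nmodType) (F : {set {set 'I_n}})
    (G : {set 'I_n} -> R) :
  (\sum_(x : 'I_n) G (component F x) = \sum_(A in components F) G A *+ #|A|)%R.
Proof.
rewrite (partition_big_imset (component F)) /=.
apply: eq_bigr => A /imsetP[x _ ->].
rewrite (eq_bigr (fun=> G (component F x))) => [|y /eqP -> //].
rewrite sumr_const; congr (_ *+ _)%R; apply: eq_card => y.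
by rewrite -component_eqE.
Qed.

Lemma sum_card_components (n : nat) (F : {set {set 'I_n}}) :
  \sum_(A in components F) #|A| = n.
Proof.
rewrite -[RHS]card_ord -sum1_card (sum_component F (fun=> 1)).
by apply: eq_bigr => A _; rewrite natn.
Qed.

Lemma component0 (n : nat) (x : 'I_n) : component set0 x = [set x].
Proof.
apply/eqP; rewrite eqEsubset sub1set component_refl andbT.
apply: component_min (set11 _) => u v /andP[_]; by rewrite inE.
Qed.

Lemma card_components0 (n : nat) : #|components (set0 : {set {set 'I_n}})| = n.
Proof.
rewrite /components (eq_imset _ (@component0 n)).
by rewrite card_imset ?cardsT ?card_ord //; apply: set1_inj.
Qed.

(** * Forests *)

(** An added edge lowers the number of components by at most one. Hence the
    cycle rank #|F| + #|components F| - n grows with F; as it vanishes on the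
    edgeless graph, it is nonnegative. *)
Lemma card_components_monotone (n : nat) (F F' : {set {set 'I_n}}) :
  F \subset F' -> F' \subset complete_edges n ->
  #|F| + #|components F| <= #|F'| + #|components F'|.
Proof.
elim: {F'}#|_| {-2}F' (erefl #|F'|) => [|k IH] F' cF' sFF' sF'K.
  move: sFF'; rewrite (cards0_eq cF') subset0 => /eqP -> //.
have [-> // | nFF'] := eqVneq F F'.
have /properP[_ [e eF' eF]] : F \proper F' by rewrite properEneq nFF'.
have cD : #|F' :\ e| = k by move: cF'; rewrite (cardsD1 e) eF' => -[].
have sFD : F \subset F' :\ e by rewrite subsetD1 sFF'.
apply: leq_trans (IH _ cD sFD (subset_trans (subD1set _ _) sF'K)) _.
rewrite cD cF' addSnnS leq_add2l -[in leqRHS](setD1K eF').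
have := subsetP sF'K _ eF'; rewrite inE => /cards2P[x [y [_ ->]]].
set D := _ :\ _; have [xy | xy] := boolP (y \in component D x).
  by rewrite components_addedge_same.
by rewrite (card_components_addedge xy).
Qed.

(** Acyclicity is expressed by a vanishing cycle rank: this form passes to
    subsets by monotonicity, and extends along an edge by counting, without any
    manipulation of cycles. *)
Definition forest (n : nat) (F : {set {set 'I_n}}) : bool :=
  (F \subset complete_edges n) && (#|F| + #|components F| == n).

Definition tree (n : nat) (T : {set {set 'I_n}}) : bool :=
  forest T && (#|components T| == 1).

Lemma forestS (n : nat) (F F' : {set {set 'I_n}}) :
  F \subset F' -> forest F' -> forest F.
Proof.
move=> sFF' /andP[sF'K /eqP cF']; have sFK := subset_trans sFF' sF'K.
rewrite /forest sFK eqn_leq -[X in _ <= X]cF' card_components_monotone //=.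
rewrite -[leqLHS]card_components0 -[leqLHS]add0n -[0 in leqLHS](@cards0 {set 'I_n}).
by apply: card_components_monotone; rewrite ?sub0set.
Qed.

Lemma forest0 (n : nat) : forest (set0 : {set {set 'I_n}}).
Proof. by rewrite /forest sub0set cards0 card_components0 eqxx. Qed.

(** The edges whose ends lie in different components. Quantifying over the ends
    of e keeps the definition free of an ordering of the two ends; crossing2 is
    the usable form. *)
Definition crossing (n : nat) (F : {set {set 'I_n}}) (e : {set 'I_n}) : bool :=
  (#|e| == 2) && [forall x in e, ~~ (e \subset component F x)].

Lemma crossing2 (n : nat) (F : {set {set 'I_n}}) (x y : 'I_n) :
  crossing F [set x; y] = (y \notin component F x).
Proof.
rewrite /crossing cards2; have [-> | nxy] /= := eqVneq x y.
  by rewrite component_refl.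
apply/forall_inP/idP => [/(_ x (set21 _ _)) | yx z].
  by rewrite subUset !sub1set component_refl.
move=> /set2P[] ->; rewrite subUset !sub1set component_refl ?andbT //.
by rewrite mem_component_sym.
Qed.

Lemma crossingP (n : nat) (F : {set {set 'I_n}}) (e : {set 'I_n}) :
  reflect (exists x y, e = [set x; y] /\ y \notin component F x) (crossing F e).
Proof.
apply: (iffP idP) => [ce | [x [y [-> xy]]]]; last by rewrite crossing2.
have /andP[/cards2P[x [y [_ E]]] _] := ce.
by exists x, y; split=> //; rewrite -crossing2 -E.
Qed.

Lemma crossing_notin (n : nat) (F : {set {set 'I_n}}) (e : {set 'I_n}) :
  crossing F e -> e \notin F.
Proof.
case/crossingP => x [y [-> xy]]; apply: contra xy => xyF.
rewrite inE; have [-> | nxy] := eqVneq x y; first exact: connect0.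
by rewrite connect1 // /adj nxy.
Qed.

Lemma forest_addedge (n : nat) (F : {set {set 'I_n}}) (e : {set 'I_n}) :
  forest F -> crossing F e -> forest (e |: F).
Proof.
move=> /andP[sFK /eqP cF] ce; have eF := crossing_notin ce.
have [e2 _] := andP ce; rewrite /forest subUset sub1set inE e2 sFK /=.
have [x [y [E xy]]] := crossingP _ _ ce.
by rewrite cardsU1 eF -[X in _ == X]cF (card_components_addedge xy) E addnS.
Qed.

(** If e joined two vertices of one component of F, adding it to F would create
    cycle rank inside T. *)
Lemma forest_crossing (n : nat) (F T : {set {set 'I_n}}) (e : {set 'I_n}) :
  forest T -> F \subset T -> e \in T -> e \notin F -> crossing F e.
Proof.
move=> fT sFT eT eF; have /andP[sTK _] := fT.
have := subsetP sTK e eT; rewrite inE => /cards2P[x [y [_ E]]].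
rewrite E crossing2; apply/negP => xy.
have /andP[_ /eqP c1] : forest (e |: F) by apply: forestS fT; rewrite subUset sub1set eT.
have /andP[_ /eqP] := forestS sFT fT.
rewrite -[RHS]c1 cardsU1 eF E components_addedge_same // add1n addSn.
exact: n_Sn.
Qed.

(** Removing one edge of a cycle leaves its ends connected by the rest of the
    cycle, which contradicts forest_crossing. *)
Lemma forest_acyclic (n : nat) (F : {set {set 'I_n}}) : forest F -> acyclic_graph F.
Proof.
move=> fF; apply/acyclic_graphP => -[//|x [//|y q]] sq uq; apply/negP.
rewrite /= -cats1 cat_path /= andbT => /and3P[xy yq zx].
set z := last y q in zx.
(* The closing edge of the cycle is removed; the path x, y, ..., z avoids it
   because x occurs only at the start and y differs from z. *)
have /andP[nzx zxF] := zx; set e := [set z; x] in zxF.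
have := forest_crossing fF (subD1set F e) zxF (negbT (setD11 _ _)).
rewrite crossing2 => /negP; apply; rewrite mem_component_sym inE.
have zq : z \in q.
  by rewrite /z; case: (q) sq => //= a l _; rewrite mem_last.
move: uq; rewrite /= in_cons negb_or => /and3P[/andP[nxy xq] yq' _].
apply/connectP; exists (y :: q) => //=; apply/andP; split.
  move: xy; rewrite /adj nxy /= in_setD1 => ->; rewrite andbT.
  apply/eqP => /setP/(_ y); rewrite !inE eqxx orbT [y == x]eq_sym (negPf nxy) orbF.
  by move/esym/eqP=> yz; rewrite yz zq in yq'.
apply: (@sub_in_path _ (predC1 x)) yq; last first.
  by rewrite /= eq_sym nxy; apply/allP => u uq /=; apply: contraNneq xq => <-.
move=> u v ux vx /andP[nuv uvF]; rewrite /adj nuv in_setD1 uvF andbT.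
apply/eqP => /setP/(_ x); rewrite !inE eqxx orbT !(eq_sym x).
by move: ux vx; rewrite !inE => /negPf -> /negPf ->.
Qed.


Lemma tree_spanning (n : nat) (T : {set {set 'I_n}}) : tree T -> is_spanning_tree T.
Proof.
move=> /andP[fT /cards1P[A cA]]; have /andP[sTK _] := fT.
rewrite /is_spanning_tree sTK forest_acyclic // andbT.
apply/forallP => x; apply/forallP => y.
have := mem_components T x; have := mem_components T y.
by rewrite cA !inE => /eqP yA /eqP xA; rewrite -[connect _ _ _]in_set -/(component T x) xA -yA component_refl.
Qed.

(** * Trees containing a given forest *)

Local Open Scope ring_scope.

Definition extensions (n : nat) (F : {set {set 'I_n}}) : {set {set {set 'I_n}}} :=
  [set T | tree T & F \subset T].

Definition component_product (n : nat) (F : {set {set 'I_n}}) : rat :=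
  \prod_(A in components F) #|A|%:R.

Lemma card_components_gt0 (n : nat) (F : {set {set 'I_n}}) (A : {set 'I_n}) :
  A \in components F -> (0 < #|A|)%N.
Proof.
by case/imsetP => x _ ->; apply/card_gt0P; exists x; apply: component_refl.
Qed.

Lemma components_gt0 (n : nat) (F : {set {set 'I_n}}) :
  (0 < n)%N -> (0 < #|components F|)%N.
Proof.
move=> n0; apply/card_gt0P; exists (component F (Ordinal n0)).
exact: mem_components.
Qed.

Lemma card_forest (n : nat) (F : {set {set 'I_n}}) :
  forest F -> (#|F| + #|components F|)%N = n.
Proof. by case/andP => _ /eqP. Qed.

Lemma card_tree (n : nat) (T : {set {set 'I_n}}) : tree T -> #|T| = n.-1.
Proof. by case/andP => fT /eqP cT; rewrite -[in RHS](card_forest fT) cT addn1. Qed.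

(** The double count: the edges of a tree T containing F that lie outside F are
    exactly its crossing edges, and there are #|components F|.-1 of them. *)
Lemma sum_extensions_crossing (n : nat) (F : {set {set 'I_n}}) :
  forest F ->
  (\sum_(e | crossing F e) #|extensions (e |: F)| =
   #|extensions F| * #|components F|.-1)%N.
Proof.
move=> fF.
under eq_bigr => e ce.
  rewrite -sum1_card.
  under eq_bigl => T do rewrite inE subUset sub1set andbCA.
  over.
rewrite (exchange_big_dep (mem (extensions F))) /=; last first.
  by move=> e T _; rewrite inE => /and3P[_ -> ->].
rewrite -sum_nat_const; apply: eq_bigr => T; rewrite inE => /andP[tT sFT].
have [fT _] := andP tT.
transitivity #|T :\: F|.
  rewrite -sum1_card; apply: eq_bigl => e; rewrite inE tT sFT !andbT.
  apply/andP/andP => [[/crossing_notin eF eT] // | [eF eT]].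
  by split=> //; apply: forest_crossing fT sFT eT eF.
rewrite cardsD (setIidPr sFT) (card_tree tT) -[in n.-1](card_forest fF).
by rewrite -!subn1 -subnDA [(1 + _)%N]addnC subnDl.
Qed.

(** The crossing edges at x correspond to their other ends. *)
Lemma crossing_at (n : nat) (F : {set {set 'I_n}}) (x : 'I_n) :
  #|[set e : {set 'I_n} | crossing F e & x \in e]| = #|~: component F x|.
Proof.
have <- : [set [set x; y] | y in ~: component F x] =
          [set e : {set 'I_n} | crossing F e & x \in e].
  apply/setP => e; apply/imsetP/idP => [[y] | ].
    by rewrite in_setC => xy ->; rewrite inE crossing2 xy set21.
  rewrite inE => /andP[/crossingP[y [z [-> yz]]]] /set2P[] -> {x}.
    by exists z; rewrite ?in_setC.
  by exists y; rewrite ?in_setC 1?setUC // mem_component_sym.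
apply: card_in_imset => y z; rewrite !in_setC => xy xz /setP/(_ y).
rewrite !inE eqxx orbT; case: eqVneq xy => [-> | _ _ /esym/eqP //].
by rewrite component_refl.
Qed.

(** The vertices of each component contribute 1 in total. *)
Lemma sum_inv_card_component (n : nat) (F : {set {set 'I_n}}) :
  \sum_(x : 'I_n) (#|component F x|%:R : rat)^-1 = #|components F|%:R.
Proof.
rewrite (sum_component F (fun A : {set 'I_n} => (#|A|%:R : rat)^-1)).
rewrite -sum1_card natr_sum; apply: eq_bigr => A /card_components_gt0 A0.
by rewrite -[LHS]mulr_natr mulVf // pnatr_eq0 -lt0n.
Qed.

Lemma sum_inv_crossing (n : nat) (F : {set {set 'I_n}}) :
  \sum_(e | crossing F e) \sum_(x in e) (#|component F x|%:R : rat)^-1 =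
  n%:R * (#|components F|%:R - 1).
Proof.
rewrite (exchange_big_dep xpredT) //=.
transitivity (\sum_(x : 'I_n) (n%:R * (#|component F x|%:R : rat)^-1 - 1)).
  apply: eq_bigr => x _; rewrite sumr_const -[LHS]mulr_natl.
  set m := #|_|; have -> : m = #|~: component F x|.
    by rewrite -crossing_at; apply: eq_card => e; rewrite inE.
  have a0 : (0 < #|component F x|)%N by apply: card_components_gt0 (mem_components F x).
  rewrite cardsCs setCK card_ord natrB; last by rewrite -[X in (_ <= X)%N]card_ord max_card.
  by rewrite mulrBl mulfV // pnatr_eq0 -lt0n.
rewrite sumrB -mulr_sumr sum_inv_card_component sumr_const card_ord.
by rewrite mulrBr mulr1.
Qed.

(** Joining components of sizes a and b replaces the factor a * b by
    a + b = a * b * (1 / a + 1 / b). *)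
Lemma component_product_addedge (n : nat) (F : {set {set 'I_n}}) (e : {set 'I_n}) :
  crossing F e ->
  component_product (e |: F) =
  component_product F * \sum_(x in e) (#|component F x|%:R : rat)^-1.
Proof.
case/crossingP => x [y [-> xy]]; rewrite /component_product.
rewrite (big_components_addedge _ _ xy) (big_components_split _ _ xy) /=.
rewrite card_component_union // big_setU1 ?big_set1 /=; last first.
  by rewrite inE; apply: contraNneq xy => ->; apply: component_refl.
have x0 : (#|component F x|%:R : rat) != 0.
  by rewrite pnatr_eq0 -lt0n; apply: card_components_gt0 (mem_components F x).
have y0 : (#|component F y|%:R : rat) != 0.
  by rewrite pnatr_eq0 -lt0n; apply: card_components_gt0 (mem_components F y).
rewrite natrD; field; by rewrite x0 y0.
Qed.

(** The count n ^ (c - 2) * (product of the component sizes) for a forest with c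
    components, multiplied by n ^ 2 so that the exponent stays natural when
    c = 1. *)
Lemma card_extensions (n : nat) (F : {set {set 'I_n}}) :
  (0 < n)%N -> forest F ->
  #|extensions F|%:R * n%:R ^+ 2 =
  n%:R ^+ #|components F| * component_product F :> rat.
Proof.
move=> n0; have := components_gt0 F n0.
case cF: #|components F| => [//|k] _.
elim: k F cF => [|k IH] F cF fF.
  have tF : tree F by rewrite /tree fF cF.
  have -> : extensions F = [set F].
    apply/setP => T; rewrite !inE; apply/andP/eqP => [[tT sFT] | ->]; last by [].
    by apply/esym/eqP; rewrite eqEcard sFT (card_tree tF) (card_tree tT) leqnn.
  have [A cA] := cards1P (introT eqP cF).
  have := sum_card_components F; rewrite /component_product cA !big_set1 => ->.
  by rewrite cards1 mul1r expr1 expr2.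
have k0 : (k.+1%:R : rat) != 0 by rewrite pnatr_eq0.
apply: (mulIf k0).
rewrite mulrAC -natrM -[k.+1]/(k.+2.-1) -cF -(sum_extensions_crossing fF) cF.
rewrite natr_sum mulr_suml.
under eq_bigr => e ce.
  have [x [y [E xy]]] := crossingP _ _ ce.
  have cE : #|components (e |: F)| = k.+1.
    by move: cF; rewrite (card_components_addedge xy) -E => -[].
  rewrite (IH _ cE (forest_addedge fF ce)) (component_product_addedge ce) mulrA.
  over.
rewrite -mulr_sumr sum_inv_crossing cF [_ ^+ k.+2]exprSr -[k.+2]addn1 natrD addrK.
by rewrite addn1 /=; ring.
Qed.

(** * Codes from maximality *)

Lemma leq_card_bigcup (I T : finType) (P : pred I) (A : I -> {set T}) :
  (#|\bigcup_(i | P i) A i| <= \sum_(i | P i) #|A i|)%N.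
Proof.
apply: (big_ind2 (fun (X : {set T}) k => #|X| <= k)%N) => [|X k Y l Xk Yl|//].
  by rewrite cards0.
by apply: leq_trans (leq_card_setU X Y) _; apply: leq_add.
Qed.

(** An inclusion-maximal code of trees covers all trees by balls of radius
    d - 1: a tree far from every codeword could be added. *)
Lemma exists_covering_code (n d : nat) :
  (0 < d)%N -> exists C : {set {set {set 'I_n}}},
    [/\ is_tree_code d C, {in C, forall S, tree S} &
        forall T, tree T -> exists2 S, S \in C & (tree_dist T S < d)%N].
Proof.
move=> d0.
pose P (C : {set {set {set 'I_n}}}) :=
  is_tree_code d C && [forall S in C, tree S].
have P0 : P set0.
  rewrite /P /is_tree_code sub0set /=.
  by apply/andP; split; apply/forall_inP => S; rewrite inE.
have [C /maxsetP[/andP[codeC /forall_inP treeC] maxC] _] := maxset_exists P0.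
exists C; split=> // T tT; apply/exists_inP; apply: contraT => /exists_inPn far.
have farC S : S \in C -> (d <= tree_dist T S)%N by move/far; rewrite -leqNgt.
have TC : T \notin C.
  apply/negP => /farC; rewrite /tree_dist setIid (card_tree tT) subn1 subnn.
  by rewrite leqNgt d0.
have : P (T |: C).
  have /andP[sC /forall_inP dC] := codeC.
  rewrite /P /is_tree_code subUset sub1set inE (tree_spanning tT) sC /=.
  apply/andP; split; apply/forall_inP => S /setU1P[-> | SC]; rewrite ?tT ?treeC //.
    apply/forall_inP => S' /setU1P[-> | S'C]; first by rewrite eqxx.
    by rewrite farC // implybT.
  apply/forall_inP => S' /setU1P[-> | S'C].
    by rewrite /tree_dist setIC farC // implybT.
  by have /forall_inP := dC S SC; apply.
by move/maxC => /(_ (subsetUr _ _)) E; move: TC; rewrite -E setU11.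
Qed.

(** Distance less than d means at least n - d common edges, of which any n - d
    form F. *)
Lemma close_trees_share (n d : nat) (S T : {set {set 'I_n}}) :
  (0 < d)%N -> (tree_dist T S < d)%N ->
  exists2 F : {set {set 'I_n}},
    F \in [set F : {set {set 'I_n}} | F \subset S & #|F| == (n - d)%N] & F \subset T.
Proof.
move=> d0 close.
have : (n - d <= #|T :&: S|)%N.
  by move: close; rewrite /tree_dist; lia.
case/card_geqP => s [us cs sTS]; exists [set F in s].
  rewrite inE cardsE (card_uniqP us) cs eqxx andbT.
  by apply/subsetP => e; rewrite inE => /sTS; rewrite inE => /andP[].
by apply/subsetP => e; rewrite inE => /sTS; rewrite inE => /andP[].
Qed.

(** Cayley's formula: every tree contains the empty forest, whose components are
    singletons. *)
Lemma card_trees (n : nat) :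
  (0 < n)%N -> #|[set T : {set {set 'I_n}} | tree T]|%:R * n%:R ^+ 2 = n%:R ^+ n :> rat.
Proof.
move=> n0; have := card_extensions n0 (forest0 n).
rewrite card_components0 /component_product /components big_imset /=; last first.
  by move=> x y _ _; rewrite !component0; apply: set1_inj.
under eq_bigr do rewrite component0 cards1.
rewrite big1_eq mulr1 => <-; congr (_%:R * _).
by apply: eq_card => T; rewrite !inE sub0set andbT.
Qed.

(** The sphere-covering count. The balls of a covering code are bounded by
    summing the extensions of all (n - d)-edge subforests of each codeword, so
    only an upper bound B on the component products remains to be supplied. *)
Lemma tree_code_lower_bound (n d : nat) (B : rat) :
  (0 < d)%N -> (d < n)%N -> 0 < B ->
  (forall F : {set {set 'I_n}}, forest F -> #|components F| = d ->
     component_product F <= B) ->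
  n%:R ^+ n / ('C(n - 1, d - 1)%:R * (n%:R ^+ d * B)) <= (max_tree_code n d)%:R :> rat.
Proof.
move=> d0 dn B0 boundB; have n0 : (0 < n)%N by apply: leq_trans dn.
have n0R : 0 < (n%:R : rat) by rewrite ltr0n.
have c0 : 0 < ('C(n - 1, d - 1)%:R : rat) by rewrite ltr0n bin_gt0 leq_sub2r // ltnW.
have [C [codeC treeC coverC]] := exists_covering_code n d0.
have CM : (#|C| <= max_tree_code n d)%N.
  exact: (leq_bigmax_cond (P := is_tree_code d) (F := fun C => #|C|) C codeC).
rewrite ler_pdivrMr ?mulr_gt0 ?exprn_gt0 //.
set W := 'C(_, _)%:R * _; apply: (@le_trans _ _ (#|C|%:R * W)); last first.
  by rewrite ler_pM2r ?ler_nat // /W !mulr_gt0 ?exprn_gt0.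
pose draws (S : {set {set 'I_n}}) :=
  [set F : {set {set 'I_n}} | F \subset S & #|F| == (n - d)%N].
have cover : [set T : {set {set 'I_n}} | tree T] \subset
    \bigcup_(S in C) \bigcup_(F in draws S) extensions F.
  apply/subsetP => T; rewrite inE => tT.
  have [S SC close] := coverC T tT.
  have [F FS FT] := close_trees_share d0 close.
  by apply/bigcupP; exists S => //; apply/bigcupP; exists F; rewrite // inE tT.
rewrite -(card_trees n0).
have := leq_trans (subset_leq_card cover) (leq_card_bigcup _ _).
rewrite -(ler_nat rat) natr_sum.
rewrite -(ler_pM2r (exprn_gt0 2 n0R)) => /le_trans; apply.
rewrite mulr_suml -sumr_const mulr_suml; apply: ler_sum => S SC; rewrite mul1r.
have /andP[fS _] := treeC S SC.
apply: (@le_trans _ _ ((\sum_(F in draws S) #|extensions F|)%:R * n%:R ^+ 2)).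
  by rewrite ler_pM2r ?exprn_gt0 // ler_nat leq_card_bigcup.
rewrite /W; have -> : 'C(n - 1, d - 1) = #|draws S|.
  rewrite cards_draws (card_tree (treeC S SC)) -subn1 -bin_sub; last by rewrite leq_sub2r // ltnW.
  by congr 'C(_, _); lia.
rewrite natr_sum mulr_suml -sumr_const mulr_suml.
apply: ler_sum => F; rewrite inE mul1r => /andP[sFS /eqP cF].
have fF := forestS sFS fS.
have cd : #|components F| = d by have := card_forest fF; lia.
by rewrite card_extensions // cd ler_pM2l ?exprn_gt0 // boundB.
Qed.

(** * Products of component sizes *)

Lemma component_product_le_AGM (n : nat) (F : {set {set 'I_n}}) :
  component_product F <= (n%:R / #|components F|%:R) ^+ #|components F|.
Proof.
rewrite /component_product.
have := (@leif_AGM rat _ (mem (components F)) (fun A : {set 'I_n} => #|A|%:R)).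
rewrite -natr_sum sum_card_components; case=> // A _; exact: ler0n.
Qed.

(** Each size satisfies a <= 2 ^ (a - 1), and the exponents a - 1 add up to n
    minus the number of components. *)
Lemma component_product_le_exp2 (n : nat) (F : {set {set 'I_n}}) :
  component_product F <= 2 ^+ (n - #|components F|).
Proof.
have -> : (n - #|components F|)%N = (\sum_(A in components F) #|A|.-1)%N.
  rewrite -[X in (X - _)%N](sum_card_components F) -sum1_card.
  rewrite -[LHS]sumnB => [|A /card_components_gt0 //].
  by apply: eq_bigr => A _; rewrite subn1.
rewrite /component_product -natr_prod -natrX ler_nat expn_sum.
apply: leq_prod => A /card_components_gt0; case: #|A| => // a _.
exact: ltn_expl.
Qed.

(** * The bounds *)

(* The exponent n - 2d is an integer and may be negative. *)
Theorem mainTheorem3 (n d : nat) (hd : (1 <= d)%N) (hdn : (d < n)%N) :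
  (('C(n - 1, d - 1)%:R : rat)^-1 * (d%:R : rat) ^+ d
     * (n%:R : rat) ^ (n%:Z - 2 * d%:Z)
   <= (max_tree_code n d)%:R :> rat) /\
  ((n%:R : rat) / 2 < d%:R ->
   ('C(n - 1, d - 1)%:R : rat)^-1 * ((n%:R : rat) / 2) ^+ (n - d)
   <= (max_tree_code n d)%:R :> rat).
Proof.
have d0 : 0 < (d%:R : rat) by rewrite ltr0n.
have n0 : 0 < (n%:R : rat) by rewrite ltr0n (leq_trans _ hdn).
have c0 : ('C(n - 1, d - 1)%:R : rat) != 0.
  by rewrite pnatr_eq0 -lt0n bin_gt0 leq_sub2r // ltnW.
split=> [|_].
  have B0 : 0 < (n%:R / d%:R : rat) ^+ d by rewrite exprn_gt0 ?divr_gt0.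
  apply: le_trans (tree_code_lower_bound hd hdn B0 _); last first.
    by move=> F _ cF; rewrite -cF component_product_le_AGM.
  rewrite expfzDr ?gt_eqF //.
  have -> : (n%:R : rat) ^ (- (2 * d%:Z)) = (n%:R ^+ d * n%:R ^+ d)^-1.
    by rewrite -exprD addnn -mul2n exprnN PoszM.
  rewrite -exprnP expr_div_n.
  rewrite le_eqVlt; apply/orP; left; apply/eqP.
  have dn0 : (d%:R : rat) ^+ d != 0 by rewrite gt_eqF ?exprn_gt0.
  have nn0 : (n%:R : rat) ^+ d != 0 by rewrite gt_eqF ?exprn_gt0.
  by rewrite !invfM invrK; ring.
have B0 : 0 < (2 : rat) ^+ (n - d) by rewrite exprn_gt0.
apply: le_trans (tree_code_lower_bound hd hdn B0 _); last first.
  by move=> F _ <-; exact: component_product_le_exp2.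
have nn0 : (n%:R : rat) ^+ d != 0 by rewrite gt_eqF ?exprn_gt0.
have -> : (n%:R : rat) ^+ n = n%:R ^+ (n - d) * n%:R ^+ d.
  by rewrite -exprD subnK // ltnW.
rewrite expr_div_n.
rewrite le_eqVlt; apply/orP; left; apply/eqP.
by field; rewrite nn0 c0 gt_eqF.
Qed.
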